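(* Let $y_1,\dots,y_r$ be integers, not all $0$, and let $X$ be the standardized abelian Cayley graph with the $1\times r$ Heuberger matrix $(y_1\;\cdots\;y_r)$. Let $e=\gcd(y_1,\dots,y_r)$. Then $X$ has loops (and therefore is not properly colorable) if and only if $e=1$; otherwise, $\chi(X)=2$ if $e$ is even, and $\chi(X)=3$ if $e$ is odd.
   Context: For an $m\times r$ integer matrix $M$, let $H\subseteq\mathbb{Z}^m$ be the subgroup generated by the columns of $M$, let $e_1,\dots,e_m$ be the standard basis of $\mathbb{Z}^m$, and let $S=\{H\pm e_1,\dots,H\pm e_m\}\subseteq \mathbb{Z}^m/H$. The standardized abelian Cayley graph with (associated) Heuberger matrix $M$ is the Cayley graph $\mathrm{Cay}(\mathbb{Z}^m/H,S)$: its vertices are the elements of $\mathbb{Z}^m/H$, and $x,y$ are adjacent if and only if $y-x\in S$. It has loops if and only if $e_j\in H$ for some $j$. $\chi$ denotes the chromatic number. *)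

(* Defs.v *)
From HB Require Import structures.
From mathcomp Require Import all_boot all_order all_algebra.
From mathcomp Require Import boolp classical_sets.

Set Implicit Arguments.
Unset Strict Implicit.
Unset Printing Implicit Defensive.

Import GRing.Theory.

Local Open Scope quotient_scope.
Local Open Scope ring_scope.

Section Graph.
Variable V : Type.

Definition has_loops (adj : V -> V -> Prop) : Prop := exists x, adj x x.

Definition proper_coloring (adj : V -> V -> Prop) (C : Type) (c : V -> C) : Prop :=
  forall x y, adj x y -> c x <> c y.

Definition n_colorable (adj : V -> V -> Prop) (n : nat) : Prop :=
  exists c : V -> 'I_n, proper_coloring adj c.

(* chi(adj) = n; no n satisfies this if there is no finite proper coloring. *)
Definition chromatic_number_eq (adj : V -> V -> Prop) (n : nat) : Prop :=
  n_colorable adj n /\ forall k, n_colorable adj k -> (n <= k)%N.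

End Graph.

Definition cayley_adj (G : zmodType) (S : set G) (x y : G) : Prop := S (y - x).

(* The smallest subgroup of G containing A; the classical [asbool] provides the
   boolean predicate required to form the quotient. *)
Definition gen_subgroup (G : zmodType) (A : set G) : {pred G} :=
  fun v => `[< forall K : zmodClosed G, (forall a, A a -> a \in K) -> v \in K >].

Lemma gen_subgroup_zmod_closed (G : zmodType) (A : set G) :
  zmod_closed (gen_subgroup A).
Proof.
split; first by apply/asboolP => K _; exact: rpred0.
move=> u v /asboolP uA /asboolP vA; apply/asboolP => K AK.
by apply: rpredB; [exact: uA | exact: vA].
Qed.

HB.instance Definition _ (G : zmodType) (A : set G) :=
  GRing.isZmodClosed.Build G (gen_subgroup A) (gen_subgroup_zmod_closed A).

Section Heuberger.
Variables (m r : nat) (M : 'M[int]_(m, r)).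

Definition column_subgroup : zmodClosed 'cV[int]_m :=
  gen_subgroup [set v | exists j : 'I_r, v = col j M].

Definition heuberger_group : zmodType := Quotient.quot column_subgroup.

Definition std_basis (i : 'I_m) : 'cV[int]_m := delta_mx i 0.

Definition heuberger_gens : set heuberger_group :=
  [set s | exists i : 'I_m,
     s = \pi_heuberger_group (std_basis i) \/
     s = \pi_heuberger_group (- std_basis i)].

Definition heuberger_adj : heuberger_group -> heuberger_group -> Prop :=
  cayley_adj heuberger_gens.

Lemma heuberger_adj_sym x y : heuberger_adj x y -> heuberger_adj y x.
Proof.
rewrite /heuberger_adj /cayley_adj /heuberger_gens /= -(opprB y x).
by case=> i [] ->; exists i; rewrite -(raddfN (\pi_heuberger_group)) ?opprK; auto.
Qed.

End Heuberger.

Arguments heuberger_adj {m r} M x y.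

(* Main.v *)
(** The columns of a one-row matrix [(y_1 ... y_r)] generate the subgroup [eZ],
    so the graph is the Cayley graph of [Z/eZ] with respect to [1] and [-1]: a
    cycle of length [e] (an infinite path if [e = 0], an edge if [e = 2], a
    vertex with a loop if [e = 1]). Parity is a proper 2-coloring when [e] is
    even; when [e] is odd it fails only across the edge from [e - 1] to [0],
    which a third color repairs, and the odd closed walk [0, 1, ..., e] excludes
    two colors. *)
Require Import Defs.
From mathcomp Require Import all_boot all_order all_algebra.
From mathcomp Require Import boolp classical_sets zify.

Import GRing.Theory.

Local Open Scope quotient_scope.
Local Open Scope ring_scope.

Lemma has_loops_uncolorable (V : Type) (adj : V -> V -> Prop) (C : Type)
  (c : V -> C) : has_loops adj -> ~ proper_coloring adj c.
Proof. by move=> [x xx] cP; exact: cP xx erefl. Qed.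

Lemma edge_colorable_ge2 (V : Type) (adj : V -> V -> Prop) (x y : V) (k : nat) :
  adj x y -> n_colorable adj k -> (2 <= k)%N.
Proof.
move=> xy [c cP]; have cxy := cP _ _ xy.
rewrite leqNgt; apply/negP => k_lt2; apply: cxy; apply: val_inj => /=.
by have := ltn_ord (c x); have := ltn_ord (c y); lia.
Qed.

(** With at most two colors, every color is [0] or [1], so its parity flips at each step of the
    walk; after an odd number of steps it cannot return to its initial value. *)
Lemma odd_closed_walk_colorable_ge3 (V : Type) (adj : V -> V -> Prop)
  (w : nat -> V) (n k : nat) :
    (forall i, adj (w i) (w i.+1)) -> w n = w 0%N -> odd n ->
  n_colorable adj k -> (3 <= k)%N.
Proof.
move=> w_adj wn n_odd [c cP]; rewrite leqNgt; apply/negP => k_lt3.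
have alternate i : odd (c (w i)) = odd i (+) odd (c (w 0%N)).
  elim: i => [|i IHi]; first by rewrite addFb.
  rewrite oddS addNb -IHi.
  have /eqP cNeq : val (c (w i)) <> val (c (w i.+1)).
    by move=> /val_inj; exact: cP (w_adj i).
  by have := ltn_ord (c (w i)); have := ltn_ord (c (w i.+1)); move: cNeq => /=; lia.
by have := alternate n; rewrite wn n_odd; case: odd.
Qed.

Definition cycle_color (n i : nat) : nat := if i == n.-1 then 2%N else odd i.

Lemma cycle_color_lt3 (n i : nat) : (cycle_color n i < 3)%N.
Proof. by rewrite /cycle_color; case: ifP => // _; case: odd. Qed.

Lemma cycle_color_succ (n i : nat) :
  (3 <= n)%N -> (i < n)%N -> cycle_color n i <> cycle_color n (i.+1 %% n)%N.
Proof.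
rewrite /cycle_color => n_ge3; rewrite leq_eqVlt => /orP[/eqP i_last|i_lt].
  by rewrite i_last modnn; do 2! case: eqP => ? /=; lia.
by rewrite modn_small //; do 2! case: eqP => ? /=; lia.
Qed.

(** Bézout: the integers [a] with [v *~ a \in K] form a subgroup of the integers, hence are closed
    under gcd and change of sign. *)
Lemma zmodClosed_biggcdn (V : zmodType) (K : zmodClosed V) (v : V) (I : finType)
  (F : I -> int) :
    (forall i, v *~ F i \in K) ->
  v *~ (\big[gcdn/0%N]_i `|F i|%N)%:Z \in K.
Proof.
move=> FK; elim/big_ind: _ => [|a b aK bK|i _]; first by rewrite mulr0z rpred0.
  have [s [t]] := Bezoutz a b; rewrite /gcdz !absz_nat => <-.
  by rewrite mulrzDr [s * _]mulrC [t * _]mulrC !mulrzA rpredD // rpredMz.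
by rewrite abszEsign mulrC mulrzA rpredMz.
Qed.

Section OneRow.
Variables (r : nat) (y : 'I_r -> int).

Let M := \row_(j < r) y j.
Let e := \big[gcdn/0%N]_(j < r) `|y j|%N.

Lemma mem_column_subgroup_row (v : 'cV[int]_1) :
  (v \in column_subgroup M) = (e %| (v 0 0)%R)%Z.
Proof.
apply/asboolP/idP => [|/dvdzP[q vE] K yK].
  (* Test the generated subgroup against one particular [K]: the vectors with entries divisible by
     [e]. *)
  move=> /(_ (GRing.ZmodClosed.clone _ (mxOver_pred (dvdz e%:Z)) _)) vK.
  have /mxOverP/(_ 0 0) // : v \is a mxOver (dvdz e%:Z).
  apply: vK => _ [j ->]; apply/(@mxOverP _ _ _ (dvdz e%:Z)) => a b; rewrite !mxE.
  by change (e %| `|y j|)%N; exact: biggcdn_inf (dvdnn _).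
(* Writing vectors as integer multiples of [1%:M] turns membership of the columns into the
   hypothesis of the Bézout lemma. *)
have scalarE (a : int) : 1%:M *~ a = a%:M :> 'cV[int]_1.
  by rewrite -raddfMz intz.
rewrite (mx11_scalar v) vE mulrC -scalarE mulrzA rpredMz //.
apply: zmodClosed_biggcdn => j; rewrite scalarE; apply: yK.
by exists j; apply/matrixP => a b; rewrite !ord1 !mxE.
Qed.

(** Two classes coincide exactly when [e] divides the difference of their representatives; the two
    disjuncts come from the generators [1] and [-1]. *)
Lemma heuberger_adj_row (u v : 'cV[int]_1) :
  heuberger_adj M (\pi u) (\pi v) <->
  (e %| (v 0 0 - u 0 0 - 1)%R)%Z \/ (e %| (v 0 0 - u 0 0 + 1)%R)%Z.
Proof.
have piE (a b : 'cV[int]_1) :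
    \pi_(heuberger_group M) a = \pi b <-> (e %| (a 0 0 - b 0 0)%R)%Z.
  split=> [/eqP|ab]; last apply/eqP; rewrite -Quotient.idealrBE;
    by rewrite mem_column_subgroup_row !mxE.
rewrite /heuberger_adj /cayley_adj -raddfB.
have e1 : std_basis (0 : 'I_1) 0 0 = 1 by rewrite mxE.
split=> [[i []]|[] d]; rewrite ?ord1.
- by move/piE; rewrite e1 !mxE; left.
- by move/piE; rewrite !mxE opprK; right.
- by exists 0; left; apply/piE; rewrite e1 !mxE.
- by exists 0; right; apply/piE; rewrite !mxE opprK.
Qed.

End OneRow.

Theorem lemma2p1 (r : nat) (y : 'I_r -> int) (hy : exists j, y j <> 0) :
  let X := heuberger_adj (\row_(j < r) y j) in
  let e := \big[gcdn/0%N]_(j < r) `|y j|%N in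
  [/\ has_loops X <-> e = 1%N,
      has_loops X -> forall (C : Type) (c : _ -> C), ~ proper_coloring X c,
      e <> 1%N -> ~~ odd e -> chromatic_number_eq X 2 &
      e <> 1%N -> odd e -> chromatic_number_eq X 3].
Proof.
move=> X e.
pose G := heuberger_group (\row_j y j).
(* The representative is arbitrary, so [val] carries information only modulo [e]. *)
pose val (x : G) : int := (repr x : 'cV_1) 0 0.
pose vtx (i : nat) : G := \pi_G (i%:Z%:M : 'cV_1).
have adjE x x' : X x x' <->
    (e %| (val x' - val x - 1)%R)%Z \/ (e %| (val x' - val x + 1)%R)%Z.
  by rewrite -{1}(reprK x) -{1}(reprK x'); exact: heuberger_adj_row.
have walk i : X (vtx i) (vtx i.+1).
  apply/heuberger_adj_row; left; rewrite !mxE /= !mulr1n.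
  by rewrite (_ : _ - _ = 0) ?dvdz0 //; lia.
have vtx_e : vtx e = vtx 0%N.
  apply/eqP; rewrite -Quotient.idealrBE mem_column_subgroup_row !mxE.
  by rewrite subr0.
split.
- split=> [[x /adjE]|e1].
    by rewrite subrr sub0r add0r !dvdzE abszN dvdn1 => -[] /eqP.
  by exists (vtx 0%N); apply/adjE; left; rewrite dvdzE e1.
- by move=> Xloop C c; exact: has_loops_uncolorable.
- move=> _ e_even; split; last by move=> k; exact: edge_colorable_ge2 (walk 0%N).
  exists (fun x => inord (odd `|val x|%N)) => x x' /adjE adj.
  move/(congr1 (@nat_of_ord _)); rewrite !inordK ?ltnS ?leq_b1 //.
  (* As [e] is even, adjacent vertices have values differing by an odd integer. *)
  have even_mul (a : int) : (e %| a)%Z -> ~~ odd `|a|.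
    by rewrite dvdzE /=; case/dvdnP=> q ->; rewrite oddM negb_and e_even orbT.
  by case: adj => /even_mul; lia.
move=> e_neq1 e_odd; split; last first.
  by move=> k; exact: odd_closed_walk_colorable_ge3 walk vtx_e e_odd.
have e_ge3 : (3 <= e)%N by case: (e) e_neq1 e_odd => [|[|[|]]].
pose res (a : int) := `|(a %% e)%Z|%N.
have e_neq0 : e%:Z != 0 by lia.
have resE a : (a %% e)%Z = (res a)%:Z by rewrite gez0_abs // modz_ge0.
have res_lt a : (res a < e)%N by rewrite -ltz_nat -resE ltz_pmod //; lia.
have res_next a b : (e %| (b - a - 1)%R)%Z -> res b = ((res a).+1 %% e)%N.
  rewrite -addrA -opprD -eqz_mod_dvd => /eqP ab.
  by rewrite {1}/res ab -modzDml (resE a) -PoszD modz_nat addn1.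
have color_next a b : (e %| (b - a - 1)%R)%Z ->
    cycle_color e (res a) <> cycle_color e (res b).
  by move=> /res_next ->; exact: cycle_color_succ.
exists (fun x => inord (cycle_color e (res (val x)))) => x x' /adjE adj.
move/(congr1 (@nat_of_ord _)); rewrite !inordK ?cycle_color_lt3 //.
case: adj => [|adj]; first exact: color_next.
(* A step by [-1] from [x] to [x'] is a step by [1] from [x'] to [x]. *)
apply/nesym/color_next.
by rewrite (_ : _ - 1 = - (val x' - val x + 1)) ?rpredN //; lia.
Qed.
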